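(* Let $f\in \mathbb{C}[x_0,\ldots,x_n]_d$ be a form with a power sum decomposition $f=l_1^d+\cdots+l_s^d$, where $l_r=\sum_{t=0}^n a_{tr}x_t$ are linear forms ($s$ is not necessarily the Waring rank of $f$). Let $A=Q/\operatorname{Ann}(f)$, let $k\in\{1,\ldots,\lfloor d/2\rfloor\}$ and $k<l\le d-k$. Let $\{\alpha_1,\ldots,\alpha_{m_k}\}$ be a monomial basis of $A_k$ and $\{\beta_1,\ldots,\beta_{m_l}\}$ a monomial basis of $A_{d-l}$, and let $W_k$, $W_{d-l}$, $D_{k,l}$ be the associated matrices defined in the context. Then: (1) $$\operatorname{Hess}_f^{(d-l,k)}=\frac{d!}{(l-k)!}\,W_{d-l}\,D_{k,l}\,W_k^{t},$$ where the factors have sizes $m_l\times s$, $s\times s$, $s\times m_k$ respectively. (2) $$\operatorname{Hess}_f^{k}=\frac{d!}{(d-2k)!}\,W_{k}\,D_{k,d-k}\,W_k^{t},$$ where the factors have sizes $m_k\times s$, $s\times s$, $s\times m_k$ respectively (this is the case $l=d-k$, with the same basis of $A_k$ used for rows and columns).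
   Context: $Q=\mathbb{C}[X_0,\ldots,X_n]$ is the ring of differential operators acting on $R=\mathbb{C}[x_0,\ldots,x_n]$ by $X_i=\partial/\partial x_i$; $\operatorname{Ann}(f)=\{\alpha\in Q:\alpha(f)=0\}$ and $A=Q/\operatorname{Ann}(f)=\bigoplus_{i=0}^d A_i$. Mixed Hessian: given bases $(\beta_i)$ of $A_{p}$ and $(\alpha_j)$ of $A_q$, $\operatorname{Hess}_f^{(p,q)}=[\beta_i\alpha_j(f)]_{i,j}$, a matrix with entries in $R$; $\operatorname{Hess}_f^k=\operatorname{Hess}_f^{(k,k)}$ (same basis for rows and columns). All Hessians here are taken with respect to the chosen bases. Matrices: write $\alpha_j=\prod_{t=0}^n X_t^{e_{tj}}$ and $\beta_i=\prod_{t=0}^n X_t^{f_{ti}}$. Put $w^{(k)}_{jr}=\prod_{t=0}^n a_{tr}^{e_{tj}}$ and $w^{(d-l)}_{ir}=\prod_{t=0}^n a_{tr}^{f_{ti}}$. Then $W_k=[w^{(k)}_{jr}]_{m_k\times s}$, $W_{d-l}=[w^{(d-l)}_{ir}]_{m_l\times s}$ and $D_{k,l}=\operatorname{Diag}(l_1^{l-k},\ldots,l_s^{l-k})$. (In the exponent and in the index $d-l$, $l$ is an integer; $l_r$ with subscript is a linear form.) *)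

(* Defs.v *)
From HB Require Import structures.
From mathcomp Require Export all_boot all_order all_algebra.
From mathcomp Require Import generic_quotient ring_quotient.
From mathcomp Require Export reals complex mpoly.

Set Implicit Arguments.
Unset Strict Implicit.
Unset Printing Implicit Defensive.

Import GRing.Theory.

Local Open Scope ring_scope.
Local Open Scope quotient_scope.

(* The ring Q of differential operators and the ring R on which it acts are
   both rendered as {mpoly K[n]}: in an operator, the variable 'X_i stands for
   the partial derivative with respect to x_i. *)

Section Apolarity.
Context {K : fieldType} {n : nat}.
Implicit Types (f p q alpha : {mpoly K[n]}) (m : 'X_{1..n}).

Definition diffop alpha f : {mpoly K[n]} :=
  \sum_(m <- msupp alpha) alpha@_m *: mderivm m f.

Lemma diffop_widen (s : seq 'X_{1..n}) alpha f :
    uniq s -> {subset msupp alpha <= s} ->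
  diffop alpha f = \sum_(m <- s) alpha@_m *: mderivm m f.
Proof.
move=> us sub; rewrite (bigID (mem (msupp alpha))) /= [X in _ + X]big1 ?addr0.
  rewrite -big_filter /diffop; apply: perm_big; apply: uniq_perm.
  - exact: msupp_uniq.
  - exact: filter_uniq.
  by move=> m; rewrite mem_filter /=; apply/idP/andP => [mp|[]//]; split=> //; exact: sub.
by move=> m /memN_msupp_eq0 ->; rewrite scale0r.
Qed.

Lemma diffop_is_linear f : linear (diffop^~ f).
Proof.
move=> c p q /=; pose s := undup (msupp p ++ msupp q ++ msupp (c *: p + q)).
have sub r : r \in [:: p; q; c *: p + q] -> {subset msupp r <= s}.
  by rewrite !inE => /or3P[] /eqP -> m mr; rewrite mem_undup !mem_cat mr ?orbT.
have us : uniq s by exact: undup_uniq.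
rewrite !(diffop_widen _ us) ?scaler_sumr -?big_split /=;
  try by apply: sub; rewrite !inE eqxx ?orbT.
by apply: eq_bigr => m _; rewrite mcoeffD mcoeffZ scalerDl scalerA.
Qed.

Definition Ann f : {pred {mpoly K[n]}} := fun alpha => diffop alpha f == 0.

Lemma Ann_submod_closed f : submod_closed (Ann f).
Proof.
split=> [|c p q]; rewrite !unfold_in /Ann; first by rewrite /diffop msupp0 big_nil.
by move=> /eqP p0 /eqP q0; rewrite diffop_is_linear p0 q0 scaler0 addr0.
Qed.

HB.instance Definition _ f :=
  GRing.isSubmodClosed.Build K {mpoly K[n]} (Ann f) (Ann_submod_closed f).

(* The library puts a ring structure on {ideal_quot I} only for a proper ideal
   I, and Ann 0 is not proper, so Q / Ann f only gets its vector space structure: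
   bases of its graded pieces do not involve its multiplication. *)
Definition apolar f := {ideal_quot (Ann f : zmodClosed {mpoly K[n]})}.

HB.instance Definition _ f := GRing.Zmodule.on (apolar f).

Definition apolar_class f alpha : apolar f :=
  \pi_({ideal_quot (Ann f : zmodClosed {mpoly K[n]})}) alpha.

Definition apolar_scale f (c : K) (x : apolar f) : apolar f :=
  apolar_class f (c *: repr x).

Lemma apolar_classP f p q :
  apolar_class f p = apolar_class f q <-> diffop (p - q) f = 0.
Proof.
rewrite /apolar_class; split => [/eqP|/eqP pq].
  by rewrite -Quotient.idealrBE => /eqP.
by apply/eqP; rewrite -Quotient.idealrBE.
Qed.

Lemma apolar_class_surj f (x : apolar f) : exists p, x = apolar_class f p.
Proof. by exists (repr x); rewrite /apolar_class reprK. Qed.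

Lemma apolar_classD f : {morph apolar_class f : p q / p + q}.
Proof. exact: raddfD. Qed.

Lemma apolar_class_scale f c p :
  apolar_scale c (apolar_class f p) = apolar_class f (c *: p).
Proof.
rewrite /apolar_scale; apply/apolar_classP; rewrite -scalerBr; apply/eqP.
have : repr (apolar_class f p) - p \in Ann f.
  by rewrite Quotient.idealrBE reprK.
exact: (@rpredZ _ _ (Ann f)).
Qed.

Fact apolar_scalerA f a b (x : apolar f) :
  apolar_scale a (apolar_scale b x) = apolar_scale (a * b) x.
Proof.
by have [p ->] := apolar_class_surj x; rewrite !apolar_class_scale scalerA.
Qed.

Fact apolar_scale1r f : left_id 1 (@apolar_scale f).
Proof.
by move=> x; have [p ->] := apolar_class_surj x; rewrite apolar_class_scale scale1r.
Qed.

Fact apolar_scalerDr f : right_distributive (@apolar_scale f) +%R.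
Proof.
move=> c x y; have [p ->] := apolar_class_surj x.
have [q ->] := apolar_class_surj y.
by rewrite -apolar_classD !apolar_class_scale scalerDr apolar_classD.
Qed.

Fact apolar_scalerDl f (x : apolar f) :
  {morph (@apolar_scale f)^~ x : a b / a + b}.
Proof.
move=> a b /=; have [p ->] := apolar_class_surj x.
by rewrite !apolar_class_scale scalerDl apolar_classD.
Qed.

HB.instance Definition _ f := GRing.Zmodule_isLmodule.Build K (apolar f)
  (@apolar_scalerA f) (@apolar_scale1r f) (@apolar_scalerDr f)
  (@apolar_scalerDl f).

Definition apolar_graded f (i : nat) (x : apolar f) : Prop :=
  exists2 p, p \is i.-homog & x = apolar_class f p.

Definition is_basis (V : lmodType K) (U : V -> Prop) (m : nat)
    (v : 'I_m -> V) : Prop :=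
  [/\ forall j, U (v j),
      forall c : 'I_m -> K, \sum_j c j *: v j = 0 -> forall j, c j = 0
    & forall x, U x -> exists c : 'I_m -> K, x = \sum_j c j *: v j].

(* A family of monomials is given by its exponent vectors: the operator with
   index j is 'X_[e j] = \prod_t X_t ^ (e j t). *)
Definition monomial_basis f (i m : nat) (e : 'I_m -> 'X_{1..n}) : Prop :=
  (forall j, mdeg (e j) = i) /\
  is_basis (@apolar_graded f i) (fun j => apolar_class f 'X_[K, e j]).

Definition mixed_hess f (p q : nat) (beta : 'I_p -> {mpoly K[n]})
    (alpha : 'I_q -> {mpoly K[n]}) : 'M[{mpoly K[n]}]_(p, q) :=
  \matrix_(i, j) diffop (beta i * alpha j) f.

Section PowerSum.
Context {s : nat}.
Implicit Type a : 'M[K]_(n, s).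

Definition linform a (r : 'I_s) : {mpoly K[n]} := \sum_t a t r *: 'X_t.

Definition Wmx a (m : nat) (e : 'I_m -> 'X_{1..n}) : 'M[K]_(m, s) :=
  \matrix_(j, r) \prod_t a t r ^+ e j t.

Definition Dmx a (k l : nat) : 'M[{mpoly K[n]}]_s :=
  diag_mx (\row_r linform a r ^+ (l - k)).

End PowerSum.

End Apolarity.

(* Main.v *)
(* A monomial operator X^m with |m| <= d sends l^d to d!/(d - |m|)! m(a) l^(d - |m|),
   where m(a) evaluates the monomial at the coefficient vector of l.  Evaluation is
   multiplicative, so the entry of the Hessian at (i, j) is
   \sum_r g_i(a_r) l_r^(d - |g_i| - |e_j|) e_j(a_r), up to the factorial factor. *)

Require Import Defs.

Set Implicit Arguments.
Unset Strict Implicit.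
Unset Printing Implicit Defensive.

Import GRing.Theory Num.Theory.

Local Open Scope ring_scope.

Section PowerSum.
Context {K : fieldType} {n s : nat}.
Implicit Types (a : 'M[K]_(n, s)) (f p : {mpoly K[n]}) (m : 'X_{1..n}).

Lemma diffopX m f : diffop 'X_[m] f = f^`M[m].
Proof. by rewrite /diffop msuppX big_seq1 mcoeffX eqxx scale1r. Qed.

Lemma mderiv_linform a r i : (linform a r)^`M(i) = (a i r)%:MP.
Proof.
rewrite /linform raddf_sum /= (bigD1 i) //= big1 ?addr0 => [|t /negPf ti].
  (* Writing [U_(i)] as [0 + U_(i)] lets the exponent left after differentiating ['X_i] cancel to
     [0]. *)
  rewrite mderivZ mderivX mnm1E eqxx scale1r -[X in (X - _)%MM]add0m addmK.
  by rewrite mpolyX0 alg_mpolyC.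
by rewrite mderivZ mderivX mnm1E ti scale0r scaler0.
Qed.

Lemma mderivXn i p d : (p ^+ d)^`M(i) = (p ^+ d.-1 * p^`M(i)) *+ d.
Proof.
elim: d => [|d IHd]; first by rewrite expr0 -mpolyC1 mderivC.
rewrite exprS mderivM IHd mulrnAr mulrA -exprS mulrC [RHS]mulrS.
(* [d.-1.+1] is [d] only for positive [d]; at [d = 0] that term has multiplicity [0]. *)
by case: d {IHd} => [|d] //=; rewrite !mulr0n.
Qed.

Lemma prod_exprU a r i :
  \prod_t a t r ^+ (U_(i)%MM : 'X_{1..n}) t = a i r.
Proof.
rewrite (bigD1 i) //= big1 ?mulr1 => [|t ti]; first by rewrite mnm1E eqxx.
by rewrite mnm1E eq_sym (negPf ti).
Qed.

Lemma prod_exprD a r m1 m2 :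
  \prod_t a t r ^+ (m1 + m2)%MM t
  = (\prod_t a t r ^+ m1 t) * \prod_t a t r ^+ m2 t.
Proof. by rewrite -big_split; apply: eq_bigr => t _; rewrite mnmDE exprD. Qed.

(** Each derivative along [X_i] multiplies by the constant [a i r] and by the current exponent,
    which then drops by one; these exponents build up the falling factorial. If [mdeg m] exceeds
    [d], that factorial is zero, so the truncated exponent is harmless. *)
Lemma mderivm_linformX a r m d :
  (linform a r ^+ d)^`M[m]
  = ((\prod_t a t r ^+ m t) *+ d ^_ (mdeg m)) *: linform a r ^+ (d - mdeg m).
Proof.
move: {2}(mdeg m) (erefl (mdeg m)) => q; elim: q m d => [|q IHq] m d mdegm.
  have /eqP -> : m == 0%MM by rewrite -mdeg_eq0 mdegm.
  by rewrite mderivm0m mdeg0 subn0 big1 ?scale1r // => t _; rewrite mnm0E.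
have [i mi] : exists i, m i != 0%N.
  apply/existsP; apply: contra_eqT mdegm => /existsPn m0.
  by rewrite mdegE big1 // => i _; exact/eqP/negPn.
(* One variable occurring in [m] is split off; its derivative is taken first and the induction
   hypothesis, at exponent [d.-1], handles the rest. *)
have mE : m = (U_(i) + (m - U_(i)))%MM by rewrite addmC submK // lep1mP.
move: (m - U_(i))%MM mE => m' mE.
move: mdegm; rewrite mE mdegD mdeg1 add1n => -[mdegm'].
rewrite mderivmDm mderivmU1m mderivXn mderiv_linform mulrC mul_mpolyC.
rewrite mderivmMn mderivmZ IHq // mdegm' prod_exprD prod_exprU scalerA scalerMnl.
by rewrite ffactnS mulrnAr -mulrnA mulnC; case: d => [|d]; rewrite ?muln0 ?mul0n.
Qed.

End PowerSum.

(** Common source of both formulas: [k] and [l] enter only through [l - k], the exponent left after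
    [p + q] derivatives. *)
Lemma mixed_hess_power_sum (K : numFieldType) (n s d p q : nat)
    (a : 'M[K]_(n, s)) (mp mq : nat)
    (g : 'I_mp -> 'X_{1..n}) (e : 'I_mq -> 'X_{1..n}) (k l : nat) :
    (forall i, mdeg (g i) = p) -> (forall j, mdeg (e j) = q) ->
    (p + q <= d)%N -> (d - (p + q) = l - k)%N ->
  mixed_hess (\sum_(r < s) linform a r ^+ d)
    (fun i => 'X_[g i]) (fun j => 'X_[e j])
  = ((d`!)%:R / ((l - k)`!)%:R)%:MP *:
    (map_mx (@mpolyC n K) (Wmx a g) *m Dmx a k l
       *m (map_mx (@mpolyC n K) (Wmx a e))^T).
Proof.
move=> degg dege pqd dE; apply/matrixP => i j; rewrite !mxE -mpolyXD diffopX.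
rewrite raddf_sum mulr_sumr /=; apply: eq_bigr => r _.
rewrite mderivm_linformX mdegD degg dege dE prod_exprD mul_mx_diag !mxE.
rewrite -mul_mpolyC mulrAC -!mpolyCM mulrA -mpolyCM; congr (_%:MP * _).
(* [d!] is [d ^_ (p + q)] times [(l - k)!], and the latter is invertible in characteristic zero. *)
rewrite -(ffact_fact pqd) dE natrM mulfK ?pnatr_eq0 -?lt0n ?fact_gt0 //.
by rewrite mulr_natl.
Qed.

Theorem lemma2p1 (R : realType) (n d s : nat)
    (a : 'M[R[i]]_(n.+1, s)) (f : {mpoly R[i][n.+1]})
    (f_homog : f \is d.-homog)
    (f_powersum : f = \sum_(r < s) linform a r ^+ d)
    (k : nat) (k_range : (1 <= k <= d./2)%N)
    (mk : nat) (e : 'I_mk -> 'X_{1..n.+1})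
    (e_basis : monomial_basis f k e) :
  (forall (l : nat) (l_range : (k < l <= d - k)%N)
          (ml : nat) (g : 'I_ml -> 'X_{1..n.+1})
          (g_basis : monomial_basis f (d - l) g),
     mixed_hess f (fun i => 'X_[g i]) (fun j => 'X_[e j])
     = ((d`!)%:R / ((l - k)`!)%:R)%:MP *:
       (map_mx (@mpolyC n.+1 R[i]) (Wmx a g) *m Dmx a k l
          *m (map_mx (@mpolyC n.+1 R[i]) (Wmx a e))^T))
  /\
  mixed_hess f (fun i => 'X_[e i]) (fun j => 'X_[e j])
  = ((d`!)%:R / ((d - 2 * k)`!)%:R)%:MP *:
    (map_mx (@mpolyC n.+1 R[i]) (Wmx a e) *m Dmx a k (d - k)
       *m (map_mx (@mpolyC n.+1 R[i]) (Wmx a e))^T).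
Proof.
have [degE _] := e_basis; have /andP[_ k_le] := k_range.
have kk_le : (k + k <= d)%N by rewrite addnn -geq_half_double.
rewrite f_powersum; split=> [l /andP[kl ld] ml g [degg _]|].
  have l_le : (l <= d)%N by exact: leq_trans ld (leq_subr _ _).
  have dE : (d - (d - l + k) = l - k)%N by rewrite subnDA subKn.
  apply: (@mixed_hess_power_sum R[i]); [exact: degg | exact: degE | | exact: dE].
  (* Adding [l] to both sides reduces [d - l + k <= d] to [k <= l]. *)
  by rewrite -(leq_add2l l) addnA subnKC // addnC leq_add2r ltnW.
(* Here [l = d - k], which equals [k] when [d = 2k], outside the range of the first part; hence the
   general lemma is applied directly, with [e] for both families. *)
rewrite mul2n -addnn subnDA.
by apply: (@mixed_hess_power_sum R[i]); [exact: degE | exact: degE | | rewrite subnDA].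
Qed.
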